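(* Let $p$ be a prime and $F\colon\mathbb F_p^n\to\mathbb F_p^m$ a surjective almost balanced function such that $\beta=0$ is an element attaining one of the two bounds $p^{n-m}\mp\sqrt{(1-p^{-m})\mathcal N_F}$ on $|F^{-1}(\beta)|$ with equality (so $F^{-1}(0)$ is the preimage with the unique preimage size). Let $\mathbf e_1=(1,0,\dots,0)\in\mathbb F_p^m$. Then (a) $W_F(b,0)=W_F(\mathbf e_1,0)$ for all $b\in\mathbb F_p^m\setminus\{0\}$; (b) $W_F(b,0)\in\mathbb Z\setminus\{0\}$ for all $b\in\mathbb F_p^m$; (c) $\mathcal N_F=\frac{p^m-1}{p^m}|W_F(\mathbf e_1,0)|^2$; (d) $p^m$ divides $W_F(\mathbf e_1,0)$; and there is a sign $\epsilon\in\{1,-1\}$ such that $$|F^{-1}(0)|=p^{n-m}+\epsilon\,\frac{p^m-1}{p^m}|W_F(\mathbf e_1,0)|\quad\text{and}\quad |F^{-1}(\beta)|=p^{n-m}-\epsilon\,\frac{1}{p^m}|W_F(\mathbf e_1,0)|$$ for every $\beta\in\mathbb F_p^m\setminus\{0\}$.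
   Context: Standard scalar product $\langle x,y\rangle=\sum_ix_iy_i$, $\zeta_p=e^{2\pi i/p}$, Walsh transform $W_F(b,a)=\sum_{x\in\mathbb F_p^n}\zeta_p^{\langle b,F(x)\rangle-\langle a,x\rangle}$, imbalance $\mathcal N_F=\frac1{p^m}\sum_{b\neq0}|W_F(b,0)|^2$. With $\mathrm{Im}(F)$ the image set, define $\Xi(F)=\sqrt{\frac{(|\mathrm{Im}(F)|-1)(|\mathrm{Im}(F)|\mathcal N_F-p^{2n-m}(p^m-|\mathrm{Im}(F)|))}{|\mathrm{Im}(F)|^2}}$; every nonempty preimage satisfies $\frac{p^n}{|\mathrm{Im}(F)|}-\Xi(F)\le|F^{-1}(\beta)|\le\frac{p^n}{|\mathrm{Im}(F)|}+\Xi(F)$. $F$ is called almost balanced if $\Xi(F)\neq0$ and some $\beta\in\mathbb F_p^m$ attains one of these bounds with equality. For surjective $F$ these bounds are $p^{n-m}\mp\sqrt{(1-p^{-m})\mathcal N_F}$. *)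

(* Defs.v *)
From HB Require Import structures.
From mathcomp Require Import all_boot all_order all_algebra.
From mathcomp Require Import complex.
From mathcomp Require Import reals trigo.
Set Implicit Arguments.
Unset Strict Implicit.
Unset Printing Implicit Defensive.
Import Order.TTheory GRing.Theory Num.Theory.
Local Open Scope ring_scope.
Local Open Scope complex_scope.

Definition sprod (K : pzRingType) (k : nat) (x y : 'rV[K]_k) : K :=
  \sum_(i < k) x 0 i * y 0 i.

(* The vector (1,0,...,0). *)
Definition e1 (K : pzRingType) (k : nat) : 'rV[K]_k :=
  \row_(j < k) (j == 0%N :> nat)%:R.

(* The modulus of a complex number, as an element of R; the norm of the
   numeric domain R[i] is instead valued in R[i]. *)
Definition cmod (R : realType) (z : R[i]) : R := ComplexField.Normc.normc z.

(* exp(2 i pi / p) *)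
Definition zeta (R : realType) (p : nat) : R[i] :=
  cos (2 * pi / p%:R) +i* sin (2 * pi / p%:R).

(* zeta_p ^ c for c in 'F_p, computed from the representative of c in
   {0, ..., p-1}. *)
Definition zeta_pow (R : realType) (p : nat) (c : 'F_p) : R[i] :=
  zeta R p ^+ (c : nat).

Section Walsh.
Variables (R : realType) (p n m : nat) (F : 'rV['F_p]_n -> 'rV['F_p]_m).

Definition walsh (b : 'rV['F_p]_m) (a : 'rV['F_p]_n) : R[i] :=
  \sum_(x : 'rV['F_p]_n) zeta_pow R (sprod b (F x) - sprod a x).

Definition imbalance : R :=
  (p%:R ^+ m)^-1 * \sum_(b : 'rV['F_p]_m | b != 0) cmod (walsh b 0) ^+ 2.

Definition image_set : {set 'rV['F_p]_m} := F @: [set: 'rV['F_p]_n].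

Definition preimage (beta : 'rV['F_p]_m) : {set 'rV['F_p]_n} :=
  F @^-1: [set beta].

Definition Xi : R :=
  let I : R := #|image_set|%:R in
  Num.sqrt ((I - 1) *
            (I * imbalance - p%:R ^ ((2 * n)%:Z - m%:Z) * (p%:R ^+ m - I))
            / I ^+ 2).

Definition attains_bound (beta : 'rV['F_p]_m) : Prop :=
  #|preimage beta|%:R = p%:R ^+ n / #|image_set|%:R - Xi \/
  #|preimage beta|%:R = p%:R ^+ n / #|image_set|%:R + Xi.

Definition almost_balanced : Prop :=
  Xi <> 0 /\ exists beta : 'rV['F_p]_m, attains_bound beta.

End Walsh.

(* Main.v *)
(** By Parseval, the imbalance is the variance sum [\sum_y d_y ^ 2] of the
    deviations [d_y = |F^-1(y)| - p^(n-m)], which sum to 0. Attaining the bound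
    at 0 is the equality case of Cauchy-Schwarz for the [d_y] with [y <> 0], so
    all these fibers have a common size [c]. By orthogonality of characters
    [W(b) = |F^-1(0)| - c] for every [b <> 0]; and
    [|F^-1(0)| - c = p^n - p^m c] is divisible by [p^m] since surjectivity forces
    [m <= n]. *)
Require Import Defs.
From HB Require Import structures.
From mathcomp Require Import all_boot all_order all_algebra.
From mathcomp Require Import complex.
From mathcomp Require Import reals trigo.
From mathcomp Require Import ring lra.
Set Implicit Arguments.
Unset Strict Implicit.
Unset Printing Implicit Defensive.
Import Order.TTheory GRing.Theory Num.Theory.
Local Open Scope ring_scope.
Local Open Scope complex_scope.

(** * Additive characters of ['F_p] and their orthogonality *)

Section ZetaCharacter.
Variables (R : realType) (p : nat).
Hypothesis p_prime : prime p.

(** De Moivre's formula. *)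
Lemma cos_sin_exp (t : R) (k : nat) :
  (cos t +i* sin t) ^+ k = cos (k%:R * t) +i* sin (k%:R * t).
Proof.
elim: k => [|k IHk]; first by rewrite mul0r cos0 sin0 expr0.
rewrite exprS IHk -natr1 mulrDl mul1r addrC cosD sinD.
by apply/eqP; rewrite eq_complex /=; apply/andP; split=> //; apply/eqP; ring.
Qed.

Lemma zeta_expp : zeta R p ^+ p = 1.
Proof.
have p0 : (p%:R : R) != 0 by rewrite pnatr_eq0 -lt0n prime_gt0.
rewrite /zeta cos_sin_exp mulrCA divff // mulr1 mulrC mulr_natr cos2pi.
by rewrite mulr2n sinDpi sinpi oppr0.
Qed.

(** As [p >= 2], the angle lies in []0, pi]], where the cosine is strictly below [cos 0]. *)
Lemma zeta_neq1 : zeta R p != 1.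
Proof.
have p_ge2 : (2 : R) <= p%:R by rewrite ler_nat prime_gt1.
have p0 : (0 : R) < p%:R by lra.
have pi0 := pi_gt0 R.
have t0 : (0 : R) < 2 * pi / p%:R by rewrite divr_gt0 // mulr_gt0.
have t_pi : 2 * pi / p%:R <= pi :> R by rewrite ler_pdivrMr // mulrC ler_pM2l.
have lt_cos : cos (2 * pi / p%:R) < cos 0 :> R.
  by rewrite ltr_cos // in_itv /= ?lexx ?t_pi ?andbT ltW.
by rewrite /zeta eq_complex /= negb_and; move: lt_cos; rewrite cos0 => /lt_eqF ->.
Qed.

Lemma zeta_pow0 : zeta_pow R (0 : 'F_p) = 1.
Proof. by rewrite /zeta_pow expr0. Qed.

Lemma zeta_pow1_neq1 : zeta_pow R (1 : 'F_p) != 1.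
Proof. exact: zeta_neq1. Qed.

(** Representatives add only modulo [p]; the reduction is harmless because [zeta ^ p = 1]. *)
Lemma zeta_powD (a b : 'F_p) : zeta_pow R (a + b) = zeta_pow R a * zeta_pow R b.
Proof.
have -> : zeta_pow R (a + b) = zeta R p ^+ ((a + b)%N %% p).
  by rewrite /zeta_pow; congr (_ ^+ (_ %% _)); exact: Fp_cast.
by rewrite expr_mod ?zeta_expp // exprD.
Qed.

Lemma zeta_pow_neq0 (a : 'F_p) : zeta_pow R a != 0.
Proof.
apply/eqP => a0; have /eqP := zeta_powD a (- a).
by rewrite subrr zeta_pow0 a0 mul0r oner_eq0.
Qed.

Lemma zeta_powN (a : 'F_p) : zeta_pow R (- a) = (zeta_pow R a)^-1.
Proof.
apply: (mulfI (zeta_pow_neq0 a)).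
by rewrite -zeta_powD subrr zeta_pow0 mulfV ?zeta_pow_neq0.
Qed.

Lemma conj_zeta_pow (a : 'F_p) : (zeta_pow R a)^* = zeta_pow R (- a).
Proof.
have norm1 : `|zeta_pow R a| = 1.
  apply/eqP; rewrite normrX normc_def /= cos2Dsin2 sqrtr1.
  by rewrite expr1n.
rewrite zeta_powN; apply: (mulfI (zeta_pow_neq0 a)).
have := normCK (zeta_pow R a); rewrite norm1 expr1n => /esym ->.
by rewrite mulfV ?zeta_pow_neq0.
Qed.

Lemma sprodDl k (x y z : 'rV['F_p]_k) : sprod (x + y) z = sprod x z + sprod y z.
Proof. by rewrite -big_split; apply: eq_bigr => i _; rewrite mxE mulrDl. Qed.

Lemma sprodC k (x y : 'rV['F_p]_k) : sprod x y = sprod y x.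
Proof. by apply: eq_bigr => i _; rewrite mulrC. Qed.

Lemma sprodBr k (x y z : 'rV['F_p]_k) : sprod x (y - z) = sprod x y - sprod x z.
Proof.
by rewrite /sprod -sumrB; apply: eq_bigr => i _; rewrite !mxE mulrBr.
Qed.

Lemma sprod0l k (y : 'rV['F_p]_k) : sprod 0 y = 0.
Proof. by rewrite /sprod big1 // => i _; rewrite mxE mul0r. Qed.

Lemma sprod0r k (x : 'rV['F_p]_k) : sprod x 0 = 0.
Proof. by rewrite sprodC sprod0l. Qed.

Lemma card_rVFp k : #|{: 'rV['F_p]_k}| = (p ^ k)%N.
Proof. by rewrite card_mx card_Fp // mul1n. Qed.

Lemma sprod_eq1_exists k (y : 'rV['F_p]_k) : y != 0 -> exists x, sprod x y = 1.
Proof.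
case/rV0Pn => j yj; exists (\row_i ((i == j)%:R / y 0 j)).
rewrite /sprod (bigD1 j) //= mxE eqxx div1r mulVf // big1 ?addr0 // => i /negPf ij.
by rewrite mxE ij !mul0r.
Qed.

(** If [y != 0], translating [x] by some [x0] with [sprod x0 y = 1] multiplies the sum by
    [zeta != 1], so it vanishes. *)
Lemma sum_zeta_pow_sprod k (y : 'rV['F_p]_k) :
  \sum_x zeta_pow R (sprod x y) = (p ^ k)%:R * (y == 0)%:R.
Proof.
have [->|/sprod_eq1_exists[x0 x0y]] := eqVneq y 0.
  under eq_bigr do rewrite sprod0r zeta_pow0.
  by rewrite sumr_const card_rVFp mulr1.
rewrite mulr0; set s := LHS.
have : s = zeta_pow R (1 : 'F_p) * s.
  rewrite {1}/s (reindex_inj (addrI x0)) mulr_sumr.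
  by apply: eq_bigr => x _; rewrite sprodDl x0y zeta_powD.
move/eqP; rewrite -subr_eq0 -{1}[s]mul1r -mulrBl mulf_eq0 subr_eq0 eq_sym.
by rewrite (negPf zeta_pow1_neq1) => /eqP.
Qed.

End ZetaCharacter.

Lemma sqr_cmod (R : realType) (z : R[i]) : (cmod z ^+ 2)%:C = z * z^*.
Proof. by rewrite rmorphXn; exact: normCK. Qed.

Lemma cmod_nat_sub (R : realType) (a b : nat) :
  cmod (a%:R - b%:R : R[i]) = `|a%:R - b%:R|.
Proof.
have -> : a%:R - b%:R = (a%:R - b%:R : R)%:C :> R[i].
  by rewrite rmorphB !rmorph_nat.
by rewrite /cmod /ComplexField.Normc.normc /= expr0n addr0 sqrtr_sqr.
Qed.

(** * Fiber sizes, Parseval and the imbalance as a variance *)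

Section Fibers.
Variables (R : realType) (p n m : nat) (F : 'rV['F_p]_n -> 'rV['F_p]_m).
Hypothesis p_prime : prime p.

Lemma sum_fibers (K : pzSemiRingType) (G : 'rV['F_p]_m -> K) :
  \sum_x G (F x) = \sum_y #|preimage F y|%:R * G y.
Proof.
rewrite (partition_big F xpredT) //=; apply: eq_bigr => y _.
under eq_bigr => x /eqP -> do [].
rewrite sumr_const mulr_natl; congr (_ *+ _).
by apply: eq_card => x; rewrite !inE.
Qed.

Lemma sum_card_fibers (K : pzSemiRingType) :
  \sum_y #|preimage F y|%:R = (p ^ n)%:R :> K.
Proof.
have := sum_fibers (fun=> 1 : K); rewrite sumr_const card_rVFp // => ->.
by apply: eq_bigr => y _; rewrite mulr1.
Qed.

Lemma walsh0E (b : 'rV['F_p]_m) :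
  walsh R F b 0 = \sum_y #|preimage F y|%:R * zeta_pow R (sprod b y).
Proof.
rewrite -(sum_fibers (fun y => zeta_pow R (sprod b y))).
by apply: eq_bigr => x _; rewrite sprod0l subr0.
Qed.

Lemma walsh00 : walsh R F 0 0 = (p ^ n)%:R.
Proof.
rewrite walsh0E -sum_card_fibers; apply: eq_bigr => y _.
by rewrite sprod0l zeta_pow0 mulr1.
Qed.

(** Each square modulus expands into a double sum over fibers [y], [z]; summing over [b] first,
    orthogonality keeps only the diagonal [y = z]. *)
Lemma parseval :
  \sum_b cmod (walsh R F b 0) ^+ 2
    = (p ^ m)%:R * \sum_y #|preimage F y|%:R ^+ 2 :> R.
Proof.
apply: (@complexI R); rewrite rmorph_sum rmorphM rmorph_nat rmorph_sum /=.
under eq_bigr => b _ do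
  rewrite sqr_cmod walsh0E rmorph_sum mulr_sumr.
rewrite exchange_big mulr_sumr /=; apply: eq_bigr => z _.
under eq_bigr => b _ do rewrite mulr_suml.
rewrite exchange_big /= (bigD1 z) //= [X in _ + X]big1 => [|y yz].
  have -> : (#|preimage F z|%:R ^+ 2)%:C = #|preimage F z|%:R ^+ 2 :> R[i].
    by rewrite rmorphXn /= rmorph_nat.
  rewrite addr0.
  transitivity (\sum_(b : 'rV['F_p]_m) (#|preimage F z|%:R ^+ 2 : R[i])).
    apply: eq_bigr => b _; rewrite (rmorphM (@conjc R)) /= conj_zeta_pow // rmorph_nat.
    by rewrite mulrACA -zeta_powD // subrr zeta_pow0 mulr1 expr2.
  by rewrite sumr_const card_rVFp // mulr_natl.
transitivity (\sum_(b : 'rV['F_p]_m)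
  (#|preimage F y|%:R * #|preimage F z|%:R * zeta_pow R (sprod b (y - z)))).
  apply: eq_bigr => b _; rewrite (rmorphM (@conjc R)) /= conj_zeta_pow // rmorph_nat.
  by rewrite mulrACA -zeta_powD // sprodBr.
by rewrite -mulr_sumr sum_zeta_pow_sprod // subr_eq0 (negPf yz) !mulr0.
Qed.

(** Removing the term [b = 0], equal to [p ^ (2 n)], from Parseval turns the second moment of the
    fiber sizes into their variance sum about the mean. *)
Lemma imbalance_variance :
  imbalance R F = \sum_y (#|preimage F y|%:R - (p ^ n)%:R / (p ^ m)%:R) ^+ 2.
Proof.
have q0 : (p ^ m)%:R != 0 :> R by rewrite pnatr_eq0 -lt0n expn_gt0 prime_gt0.
have := parseval; rewrite (bigD1 0) //= walsh00.
have -> : cmod (p ^ n)%:R = (p ^ n)%:R :> R.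
  by have := cmod_nat_sub R (p ^ n) 0; rewrite !subr0 normr_nat.
rewrite /imbalance -[p%:R ^+ m]natrX; set A := \sum_(b | _) _; set B := \sum_y _.
set Q := (p ^ m)%:R in q0 *; set S := (p ^ n)%:R => AB.
have -> : A = Q * B - S ^+ 2 by rewrite -AB; ring.
under [RHS]eq_bigr => y _ do rewrite sqrrB.
rewrite big_split sumrB /= -/B sumr_const card_rVFp // sumrMnl -mulr_suml.
rewrite sum_card_fibers -/S -(mulr_natl ((S / Q) ^+ 2)) -/Q.
by field.
Qed.

End Fibers.

(* For [y != t] the deviations [(#|T| - 1) f y + f t] have zero square sum: this
   is the equality case of Cauchy-Schwarz on the complement of [t]. *)
Lemma extremal_deviation (K : realFieldType) (T : finType) (t : T) (f : T -> K) :
  \sum_y f y = 0 ->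
  #|T|%:R * f t ^+ 2 = (#|T|%:R - 1) * \sum_y f y ^+ 2 ->
  forall y, y != t -> (#|T|%:R - 1) * f y = - f t.
Proof.
set N : K := #|T|%:R; rewrite (bigD1 t) //= => sum0 ext y yt.
move: ext; rewrite (bigD1 t) //=; set A := \sum_(y | _) _ => ext.
set B := \sum_(y | _) _ in sum0.
have sum_cst : \sum_(y | y != t) f t ^+ 2 = (N - 1) * f t ^+ 2.
  have : \sum_(y : T) f t ^+ 2 = N * f t ^+ 2 by rewrite sumr_const mulr_natl.
  by rewrite (bigD1 t) //= mulrBl mul1r => <-; rewrite addrC addrK.
have eqB : B = - f t by apply/eqP; rewrite -addr_eq0 addrC sum0.
have dev0 : \sum_(y | y != t) ((N - 1) * f y + f t) ^+ 2 = 0.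
  transitivity ((N - 1) ^+ 2 * A + 2 * (N - 1) * f t * B + (N - 1) * f t ^+ 2).
    rewrite -sum_cst /A /B !mulr_sumr -!big_split /=.
    by apply: eq_bigr => z _; ring.
  transitivity ((N - 1) * ((N - 1) * A - f t ^+ 2)); first by rewrite eqB; ring.
  (* With the term at [t] split off, [ext] reads [N f_t^2 = (N - 1) (f_t^2 + A)]. *)
  have -> : (N - 1) * A = f t ^+ 2 by lra.
  by rewrite subrr mulr0.
have /psumr_eq0P : forall z, z != t -> 0 <= ((N - 1) * f z + f t) ^+ 2.
  by move=> z _; exact: sqr_ge0.
by move=> /(_ dev0 y yt)/eqP; rewrite sqrf_eq0 addr_eq0 => /eqP.
Qed.

(** * From the attained bound to fiber sizes and Walsh values *)

Theorem theorem4p1 (R : realType) (p n m : nat)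
    (F : 'rV['F_p]_n -> 'rV['F_p]_m)
    (p_prime : prime p)
    (F_surj : forall y : 'rV['F_p]_m, exists x : 'rV['F_p]_n, F x = y)
    (F_ab : almost_balanced R F)
    (F_0 : let r : R :=
             Num.sqrt ((1 - (p%:R ^+ m)^-1) * imbalance R F) in
           #|preimage F 0|%:R = p%:R ^ (n%:Z - m%:Z) - r \/
           #|preimage F 0|%:R = p%:R ^ (n%:Z - m%:Z) + r) :
  let W : 'rV['F_p]_m -> R[i] := fun b => walsh R F b 0 in
  let w : R := cmod (W (e1 'F_p m)) in
  [/\ (forall b : 'rV['F_p]_m, b != 0 -> W b = W (e1 'F_p m)),
      (forall b : 'rV['F_p]_m, exists2 z : int, z != 0 & W b = z%:~R),
      imbalance R F = (p%:R ^+ m - 1) / p%:R ^+ m * w ^+ 2,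
      (exists2 z : int, ((p ^ m)%N%:Z %| z)%Z & W (e1 'F_p m) = z%:~R) &
      exists2 eps : R, eps = 1 \/ eps = -1 &
        #|preimage F 0|%:R
          = p%:R ^ (n%:Z - m%:Z) + eps * ((p%:R ^+ m - 1) / p%:R ^+ m * w) /\
        forall beta : 'rV['F_p]_m, beta != 0 ->
          #|preimage F beta|%:R
            = p%:R ^ (n%:Z - m%:Z) - eps * ((p%:R ^+ m)^-1 * w)].
Proof.
move=> W w.
set q := (p ^ m)%N; pose Q : R := q%:R; pose N y := #|preimage F y|.
have q_gt0 : (0 < q)%N by rewrite expn_gt0 prime_gt0.
have Q0 : Q != 0 by rewrite pnatr_eq0 -lt0n.
have p0 : p%:R != 0 :> R by rewrite pnatr_eq0 -lt0n prime_gt0.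
have imgT : image_set F = [set: 'rV['F_p]_m].
  apply/setP => y; rewrite inE; have [x <-] := F_surj y.
  by apply/imsetP; exists x.
(* For a full image, [Xi ^ 2] is a multiple of the imbalance. *)
have imb0 : imbalance R F != 0.
  apply/eqP => i0; case: F_ab => Xi0 _; apply: Xi0.
  by rewrite /Xi imgT cardsT card_rVFp // -natrX subrr i0 !mulr0 subr0 mulr0 mul0r sqrtr0.
(* If [m = 0] the image is a single point and the factor [|Im F| - 1] makes [Xi] vanish. Positivity
   of [m] makes [e1] nonzero. *)
have m_gt0 : (0 < m)%N.
  rewrite lt0n; apply/eqP => m0; case: F_ab => Xi0 _; apply: Xi0.
  have q1 : (p ^ m)%N = 1%N by rewrite m0.
  by rewrite /Xi imgT cardsT card_rVFp // q1 subrr !mul0r sqrtr0.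
have q_gt1 : (1 < q)%N by rewrite -(expn0 p) ltn_exp2l ?prime_gt1.
have Q1 : Q - 1 != 0 by rewrite subr_eq0 -[1]/(1%:R) eqr_nat gtn_eqF.
have le_mn : (m <= n)%N.
  rewrite -(leq_exp2l _ _ (prime_gt1 p_prime)) -!(card_rVFp p_prime).
  by rewrite -[leqLHS]cardsT -imgT -[leqRHS]cardsT leq_imset_card.
have e1_neq0 : e1 'F_p m != 0.
  apply/rV0Pn; exists (Ordinal m_gt0); by rewrite mxE eqxx oner_eq0.
have mean : p%:R ^ (n%:Z - m%:Z) = (p ^ n)%:R / Q.
  by rewrite expfzDr // -exprnN -exprnP /Q !natrX.
pose d y : R := (N y)%:R - (p ^ n)%:R / Q.
have imbE : imbalance R F = \sum_y d y ^+ 2 := imbalance_variance R F p_prime.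
have sum_d : \sum_y d y = 0.
  by rewrite sumrB sum_card_fibers // sumr_const card_rVFp // -(mulr_natr (_ / Q)) divfK ?subrr.
have imb_ge0 : 0 <= imbalance R F by rewrite imbE sumr_ge0 // => y _; exact: sqr_ge0.
(* Squaring merges the two cases of [F_0]; the sign is recovered at the end from that of
   [N 0 - c]. *)
have d0_sqr : d 0 ^+ 2 = (1 - Q^-1) * imbalance R F.
  have r_ge0 : 0 <= (1 - Q^-1) * imbalance R F.
    rewrite mulr_ge0 // subr_ge0 invf_le1 ?ltr0n // -[1]/(1%:R) ler_nat //.
  move: F_0; rewrite mean -natrX -/q -/Q -/(N 0) /d => -[] ->.
    by rewrite addrAC subrr sub0r sqrrN sqr_sqrtr.
  by rewrite addrAC subrr add0r sqr_sqrtr.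
have dE y : y != 0 -> (Q - 1) * d y = - d 0.
  have := @extremal_deviation R _ 0 d sum_d; rewrite card_rVFp // -/q -/Q.
  by apply; rewrite -imbE d0_sqr; field.
pose c := N (e1 'F_p m).
have Nc y : y != 0 -> N y = c.
  move=> y0; apply/eqP; rewrite -(eqr_nat R); apply/eqP.
  apply: (@addIr _ (- ((p ^ n)%:R / Q))); apply: (mulfI Q1).
  by rewrite -/(d y) -/(d _) !dE.
have pnE : (p ^ n)%:R = (N 0)%:R + (Q - 1) * c%:R :> R.
  (* The count comes from [dE] at [e1]: the means in [(Q - 1) d(e1) + d(0)] add up to [p ^ n]. *)
  apply/eqP; rewrite eq_sym -subr_eq0.
  have -> : (N 0)%:R + (Q - 1) * c%:R - (p ^ n)%:R = (Q - 1) * d (e1 'F_p m) + d 0.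
    by rewrite /d -/c; field.
  by rewrite dE // addNr.
have WE b : b != 0 -> W b = (N 0)%:R - c%:R.
  move=> b0; rewrite /W walsh0E // (bigD1 0) //= sprod0r zeta_pow0 mulr1.
  (* The full character sum is 0 and [y = 0] contributes 1. *)
  have E : \sum_(y | y != 0) zeta_pow R (sprod b y) = -1.
    have := sum_zeta_pow_sprod R p_prime b.
    rewrite (negPf b0) mulr0 (bigD1 0) //= sprod0l zeta_pow0 => /eqP.
    rewrite addrC addr_eq0 => /eqP <-.
    by apply: eq_bigr => y _; rewrite sprodC.
  under eq_bigr => y y0 do rewrite -/(N y) (Nc _ y0).
  by rewrite -mulr_sumr E mulrN1.
have wE : w = `|(N 0)%:R - c%:R| by rewrite /w WE // cmod_nat_sub.
have d0E : d 0 = (Q - 1) / Q * ((N 0)%:R - c%:R).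
  by rewrite /d pnE; field.
have imbW : imbalance R F = (Q - 1) / Q * w ^+ 2.
  have -> : w ^+ 2 = ((N 0)%:R - c%:R) ^+ 2 by rewrite wE real_normK ?num_real.
  (* After scaling by [(Q - 1) / Q], both sides equal [d 0 ^+ 2], by [d0_sqr] and by [d0E]. *)
  apply: (mulfI Q1); apply: (mulIf (invr_neq0 Q0)).
  transitivity (d 0 ^+ 2); first by rewrite d0_sqr; field.
  by rewrite d0E; field.
(* Equal sizes would give [w = 0], hence a zero imbalance. *)
have N0c : N 0 != c.
  apply: contra_neq imb0 => E; rewrite imbW wE E subrr normr0 expr0n mulr0 //.
have WZ b : b != 0 -> W b = ((N 0)%:Z - c%:Z)%:~R.
  by move=> b0; rewrite WE // intrB.
rewrite -natrX -/q -/Q.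
split.
- by move=> b b0; rewrite !WE.
- move=> b; have [->|b0] := eqVneq b 0.
    exists (p ^ n)%N%:Z; last by rewrite /W walsh00.
    by rewrite eqz_nat -lt0n expn_gt0 prime_gt0.
  by exists ((N 0)%:Z - c%:Z); [rewrite subr_eq0 eqz_nat | exact: WZ].
- exact: imbW.
- exists ((N 0)%:Z - c%:Z); last exact: WZ.
  (* In this form both terms are multiples of [q], the first because [m <= n]. *)
  have -> : (N 0)%:Z - c%:Z = (p ^ n)%N%:Z - q%:Z * c%:Z.
    apply: (@intr_inj R); rewrite !intrB intrM -!pmulrn pnE; ring.
  by rewrite rpredB ?dvdz_mulr // dvdzE /= dvdn_exp2l.
(* Both size formulas follow once [e] is the sign of [N 0 - c], as [w] is its absolute value. *)
have mainE (e : R) : (N 0)%:R - c%:R = e * w ->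
  (N 0)%:R = p%:R ^ (n%:Z - m%:Z) + e * ((Q - 1) / Q * w) /\
  forall y, y != 0 -> (N y)%:R = p%:R ^ (n%:Z - m%:Z) - e * (Q^-1 * w).
  move=> eE; split=> [|y y0].
    by rewrite mulrCA -eE -d0E mean /d addrC subrK.
  by rewrite mulrCA -eE mean (Nc _ y0) pnE; field.
have [s|s] := lerP 0 ((N 0)%:R - c%:R : R).
- exists 1; first by left.
  by apply: mainE; rewrite mul1r wE ger0_norm.
- exists (- 1); first by right.
  by apply: mainE; rewrite mulN1r wE ltr0_norm // opprK.
Qed.
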